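(* There is an absolute constant $c>0$ such that $r(P_n^{2}, P_n^{2}) < c\, n^{19.487}$ for all integers $n>1$.
   Context: For integers $\ell\ge 1$ and $n\ge 1$, the $\ell$th power $P_n^{\ell}$ of the ordered path is the ordered graph with vertices $v_1<v_2<\cdots<v_n$ and edge set $\{v_iv_j : 1\le |i-j|\le \ell\}$. A copy of an ordered graph on $v_1<\cdots<v_n$ in a 2-coloring of the edges of the complete graph on $[N]=\{1,\dots,N\}$ is given by vertices $x_1<\cdots<x_n$ in $[N]$ such that $x_ix_j$ is an edge of the copy whenever $v_iv_j$ is an edge; it is monochromatic red (blue) if all these edges are red (blue). The ordered Ramsey number $r(P_s^{\ell}, P_n^{\ell})$ is the minimum $N$ such that every red/blue coloring of $\binom{[N]}{2}$ contains a red copy of $P_s^{\ell}$ or a blue copy of $P_n^{\ell}$. *)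

(* Defs.v *)
From mathcomp Require Import all_boot all_order all_algebra.
From mathcomp Require Import zify.

Set Implicit Arguments.
Unset Strict Implicit.
Unset Printing Implicit Defensive.

(* An ordered graph on n vertices is a relation on 'I_n, with the order of
   'I_n; the vertex v_i is the ordinal of value i - 1. *)
Definition path_power (l n : nat) : rel 'I_n :=
  fun i j => 1 <= `|(i : int) - (j : int)|%N <= l.

(* Only the values of a coloring at the two-element subsets of 'I_N, that is at
   the edges of the complete graph, matter; [true] is red, [false] is blue. *)
Definition coloring (N : nat) := {ffun {set 'I_N} -> bool}.

Definition mono_copy (N : nat) (c : coloring N) (b : bool) (n : nat)
    (G : rel 'I_n) : bool :=
  [exists x : {ffun 'I_n -> 'I_N},
    [forall i : 'I_n, forall j : 'I_n, (i < j) ==> (x i < x j)] &&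
    [forall i : 'I_n, forall j : 'I_n, G i j ==> (c [set x i; x j] == b)]].

Definition ramsey_prop (l s n N : nat) : bool :=
  [forall c : coloring N,
    mono_copy c true (path_power l (n := s)) ||
    mono_copy c false (path_power l (n := n))].

Lemma ramsey_seq (T : eqType) (e : rel T) (s n : nat) (l : seq T) :
  2 ^ (s + n) <= size l ->
  exists2 k, subseq k l &
    (size k = s /\ pairwise e k) \/
    (size k = n /\ pairwise (fun x y => ~~ e x y) k).
Proof.
move: {2}(s + n) (erefl (s + n)) => k.
elim: k s n l => [|k IHk] s n l.
  by case: s => [|s] // _ _; exists [::]; [exact: sub0seq | left].
case: s => [|s] sn; first by exists [::]; [exact: sub0seq | left].
case: n sn => [|n] sn; first by exists [::]; [exact: sub0seq | right].
case: l => [|x l]; first by rewrite leqNgt expn_gt0.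
rewrite addSn expnS mul2n -addnn -(count_predC (e x) (x :: l)) => sz.
have sub (a : pred T) t : subseq t (filter a l) ->
    subseq (x :: t) (x :: l) /\ all a t.
  by rewrite subseq_filter /= eqxx => /andP[].
have sz' : (2 ^ (s + n.+1) <= count (e x) l) ||
           (2 ^ (s + n.+1) <= count (predC (e x)) l).
  by move: sz => /=; case: (e x x) => /=; lia.
case/orP: sz'; rewrite -size_filter => le1.
  have [|t st [[<- pt]|[st' pt]]] := IHk s n.+1 _ _ le1.
  - by move: sn; rewrite addSn => -[].
  - have [st2 at_] := sub _ _ st; exists (x :: t) => //; left; split=> //=.
    by rewrite at_.
  - exists t; last by right.
    exact: subseq_trans (subseq_trans st (filter_subseq _ _)) (subseq_cons _ _).
rewrite addnS -addSn in le1.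
have [|t st [[st' pt]|[<- pt]]] := IHk s.+1 n _ _ le1.
- by move: sn; rewrite addnS => -[].
- exists t; last by left.
  exact: subseq_trans (subseq_trans st (filter_subseq _ _)) (subseq_cons _ _).
have [st2 at_] := sub _ _ st; exists (x :: t) => //; right; split=> //=.
by rewrite at_.
Qed.

Lemma mono_copy_seq (N : nat) (c : coloring N) (b : bool) (l n : nat)
    (k : seq 'I_N) :
  subseq k (enum 'I_N) -> size k = n ->
  pairwise (fun x y => c [set x; y] == b) k ->
  mono_copy c b (path_power l (n := n)).
Proof.
move=> sk sn pk.
have pl : pairwise (fun x y : 'I_N => x < y) k.
  apply: subseq_pairwise sk _.
  rewrite -(@pairwise_map _ _ val ltn) val_enum_ord.
  by rewrite -(sorted_pairwise ltn_trans) iota_ltn_sorted.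
have ltk (i : 'I_n) : i < size k by rewrite sn.
apply/existsP; exists [ffun i : 'I_n => tnth (in_tuple k) (Ordinal (ltk i))].
have nthE x0 (i : 'I_n) : tnth (in_tuple k) (Ordinal (ltk i)) = nth x0 k i.
  by rewrite (tnth_nth x0).
apply/andP; split; apply/forallP => i; apply/forallP => j; apply/implyP;
    rewrite !ffunE; have x0 := tnth (in_tuple k) (Ordinal (ltk i));
    rewrite !(nthE x0).
  by move=> ij; apply: (pairwiseP x0 pl); rewrite ?inE.
rewrite /path_power => ij.
have [lt_ij|lt_ji|eq_ij] := ltngtP i j; last by move: ij; lia.
  by apply: (pairwiseP x0 pk); rewrite ?inE.
by rewrite setUC; apply: (pairwiseP x0 pk); rewrite ?inE.
Qed.

Lemma ramsey_prop_ex (l s n : nat) : exists N, ramsey_prop l s n N.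
Proof.
exists (2 ^ (s + n)); apply/forallP => c; apply/orP.
have [|k sk kP] :=
    @ramsey_seq _ (fun x y => c [set x; y]) s n (enum 'I_(2 ^ (s + n))).
  by rewrite size_enum_ord.
case: kP => -[sz pk]; [left | right]; apply: mono_copy_seq sk sz _.
  by apply: sub_pairwise pk => x y /= ->.
by apply: sub_pairwise pk => x y /= /negbTE ->.
Qed.

Definition ordered_ramsey (l s n : nat) : nat := ex_minn (ramsey_prop_ex l s n).

(* Main.v *)
(* In fact r(P_n^2, P_n^2) = O(n^10).  It is enough to show
   r(P_2s^2, P_2t^2) <= 32 M for M = max(r(P_s^2, P_2t^2), r(P_2s^2, P_t^2)).
   If there is neither a red P_2s^2 nor a blue P_2t^2, then every set of M
   vertices contains both a red P_s^2 and a blue P_t^2.  Call a red edge long if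
   it is the last edge of a red square of a path on more than s vertices.  Each
   vertex y has fewer than M short red edges to the left, for a red P_s^2 among
   the left ends would make one of them long, and fewer than M long red edges to
   the right, for a red P_s^2 among the right ends would continue a long edge to
   a red P_2s^2.  If xy is long and yz is short, then xz is blue, so the left ends
   of long red edges at y or the right ends of short ones number less than M:
   otherwise a blue P_t^2 on each side gives a blue P_2t^2.  Hence y has red
   in-degree or red out-degree less than 2M, and similarly for blue.  On each of
   the four resulting classes of vertices, every edge can be charged to one of its
   ends, fewer than 4M to each end, so each class has fewer than 8M vertices. *)

Require Import Defs.
From mathcomp Require Import all_boot all_order all_algebra.
From mathcomp Require Import all_classical all_reals all_analysis.
From mathcomp Require Import zify lra.

Set Implicit Arguments.
Unset Strict Implicit.
Unset Printing Implicit Defensive.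

(** * Square paths in a vertex set *)

(** A copy of the square of a path, kept as a list so that copies can be concatenated or overlapped;
    the increasing order of the vertices is left to the relation [e]. *)
Fixpoint sqpath (T : finType) (e : rel T) (V : {set T}) (w : seq T) : bool :=
  if w is x :: w' then
    [&& x \in V, all (e x) (take 2 w') & sqpath e V w']
  else true.

Section SquarePaths.
Variables (T : finType) (e : rel T).
Implicit Types (V A B : {set T}) (w : seq T).

Lemma sqpath_mem V w : sqpath e V w -> {subset w <= V}.
Proof.
elim: w => [//|x w IHw] /= /and3P[xV _ /IHw wV] y.
by rewrite inE => /orP[/eqP->|/wV].
Qed.

Lemma sqpath_cat V A B w w' :
  A \subset V -> B \subset V ->
  (forall x y, x \in A -> y \in B -> e x y) ->
  sqpath e A w -> sqpath e B w' -> sqpath e V (w ++ w').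
Proof.
move=> AV BV eAB pw pw'; have w'B := sqpath_mem pw'.
elim: w pw => [_|x w IHw] /=.
  elim: w' pw' {w'B} => [//|x w IHw] /= /and3P[/(fintype.subsetP BV)-> -> /IHw].
  by [].
move=> /and3P[xA xw /IHw->]; rewrite (fintype.subsetP AV) //= andbT.
apply/allP => z; rewrite take_cat; case: ltnP => sw; first exact: (allP xw).
rewrite mem_cat => /orP[zw|/mem_take/w'B zB]; last exact: eAB.
by apply: (allP xw); rewrite take_oversize.
Qed.

(** Edges span at most two steps, so none jumps over the two shared vertices. *)
Lemma sqpath_glue V w x y w' :
  sqpath e V (w ++ [:: x; y]) -> sqpath e V [:: x, y & w'] ->
  sqpath e V (w ++ [:: x, y & w']).
Proof.
move=> + pw'; elim: w => [//|z w IHw] /= /and3P[-> + /IHw->].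
by case: w {IHw} => [|a [|b w]]; rewrite /= ?take0 => ->.
Qed.

Lemma sqpath_nth V w x0 i j :
  sqpath e V w -> i < j <= i.+2 -> j < size w -> e (nth x0 w i) (nth x0 w j).
Proof.
elim: w i j => [//|x w IHw] [|i] [|j] //= /and3P[_ xw pw] ij jw.
  apply: (allP xw); rewrite -(@nth_take 2) //.
  by rewrite mem_nth // size_take; case: ifP => //; lia.
exact: IHw.
Qed.

End SquarePaths.

(** * Degree bounds *)

(** Out-degrees and in-degrees within [X] have the same sum, so [#|X| ^ 2] is at most
    [#|X| * (1 + 2 * (d - 1))]. *)
Lemma tournament_card (T : finType) (r : rel T) (X : {set T}) (d : nat) :
  0 < d -> {in X &, forall u v, u != v -> r u v || r v u} ->
  {in X, forall u, #|[set v in X | r u v]| < d} -> #|X| < d.*2.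
Proof.
move=> d0 rX dX; have [->|X0] := posnP #|X|; first by rewrite double_gt0.
have E : \sum_(u in X) #|[set v in X | r v u]| =
         \sum_(u in X) #|[set v in X | r u v]|.
  under eq_bigr => u _ do rewrite -sum1dep_card big_mkcondr /=.
  rewrite exchange_big /=; apply: eq_bigr => u _.
  by rewrite -sum1dep_card big_mkcondr.
have : \sum_(u in X) #|X| <= \sum_(u in X)
   (1 + (#|[set v in X | r u v]| + #|[set v in X | r v u]|)).
  apply: leq_sum => u uX.
  rewrite -(cards1 u); apply: leq_trans (leq_add (leqnn _) (leq_card_setU _ _)).
  apply: leq_trans (leq_card_setU _ _); apply/subset_leq_card/fintype.subsetP => v vX.
  rewrite !inE vX /= eq_sym; case: eqVneq => //= uv; exact: rX.
rewrite !big_split /= E !sum_nat_const muln1 => le1.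
have le2 : \sum_(u in X) #|[set v in X | r u v]| <= \sum_(u in X) d.-1.
  by apply: leq_sum => u /dX; lia.
rewrite sum_nat_const in le2; nia.
Qed.

Lemma indegree_or_outdegree_small (N : nat) (V : {set 'I_N}) (M : nat)
    (e e' : rel 'I_N) (s t : nat) :
  0 < s ->
  (forall x y, e x y -> x < y) ->
  (forall x y : 'I_N, x < y -> e x y || e' x y) ->
  (forall A : {set 'I_N}, A \subset V -> M <= #|A| ->
    exists2 w, sqpath e A w & s <= size w) ->
  (forall A : {set 'I_N}, A \subset V -> M <= #|A| ->
    exists2 w, sqpath e' A w & t <= size w) ->
  (forall w, sqpath e V w -> size w < s.*2) ->
  (forall w, sqpath e' V w -> size w < t.*2) ->
  forall y, y \in V ->
  (#|[set x in V | e x y]| < M.*2) || (#|[set z in V | e y z]| < M.*2).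
Proof.
move=> s0 elt ee' He He' Ne Ne' y yV.
(* The path has [size w + 2] vertices, so the size condition asks for more than [s] of them. *)
pose long x z := `[< exists2 w, sqpath e V (w ++ [:: x; z]) & s <= (size w).+1 >].
pose inS := [set x in V | e x y & ~~ long x y].
pose inL := [set x in V | e x y & long x y].
pose outS := [set z in V | e y z & ~~ long y z].
pose outL := [set z in V | e y z & long y z].
have inSV : inS \subset V by apply/fintype.subsetP => x; rewrite inE => /andP[].
have inLV : inL \subset V by apply/fintype.subsetP => x; rewrite inE => /andP[].
have outSV : outS \subset V by apply/fintype.subsetP => x; rewrite inE => /andP[].
have outLV : outL \subset V by apply/fintype.subsetP => x; rewrite inE => /andP[].
have y1V : [set y] \subset V by rewrite finset.sub1set.
have inS_small : #|inS| < M.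
  rewrite ltnNge; apply/negP => /(He _ inSV)[w pw].
  case/lastP: w pw => [|w b] pw; first by rewrite leqNgt s0.
  rewrite size_rcons => sw.
  have /(sqpath_mem pw) : b \in rcons w b by rewrite mem_rcons mem_head.
  rewrite inE => /and3P[_ _ /asboolPn]; apply; exists w => //.
  rewrite -(cat_rcons b w [:: y]); apply: (sqpath_cat inSV y1V) pw _.
    by move=> x z; rewrite !inE => /and3P[_ exy _] /eqP->.
  by rewrite /= inE eqxx.
have outL_small : #|outL| < M.
  rewrite ltnNge; apply/negP => /(He _ outLV)[[|c w] pw]; first by rewrite leqNgt s0.
  move=> /= sw.
  have /(sqpath_mem pw) : c \in c :: w by rewrite mem_head.
  rewrite inE => /and3P[_ _ /asboolP[w' pw' sw']].
  (* The paths overlap in the long edge from [y] to [c]: [w'] and [y] supply at least [s] vertices,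
     [c :: w] at least [s] more. *)
  suff /Ne : sqpath e V (w' ++ [:: y, c & w]).
    by rewrite ltnNge size_cat /= -addnn addnS -addSn leq_add.
  apply: sqpath_glue pw' _.
  apply: (sqpath_cat y1V outLV (w := [:: y])) pw => //.
    by move=> x z; rewrite !inE => /eqP-> /and3P[].
  by rewrite /= inE eqxx.
have : (#|inL| < M) || (#|outS| < M).
  rewrite -[X in X || _]negbK -implybE -!leqNgt; apply/implyP => inL_big.
  rewrite ltnNge; apply/negP => outS_big.
  have [w pw sw] := He' _ inLV inL_big.
  have [w' pw' sw'] := He' _ outSV outS_big.
  suff /Ne' : sqpath e' V (w ++ w') by rewrite ltnNge size_cat -addnn leq_add.
  apply: sqpath_cat inLV outSV _ pw pw' => x z.
  rewrite !inE => /and3P[xV exy /asboolP[v pv sv]] /and3P[zV eyz /asboolPn nl].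
  case/orP: (ee' _ _ (ltn_trans (elt _ _ exy) (elt _ _ eyz))) => // exz.
  (* An [e]-edge from [x] to [z] would let the path ending in the long edge [x], [y] continue to
     [z], making the edge from [y] to [z] long. *)
  case: nl; exists (rcons v x); last by rewrite size_rcons; lia.
  by rewrite cat_rcons; apply: sqpath_glue pv _; rewrite /= exy exz eyz xV yV zV.
have inU : #|[set x in V | e x y]| <= #|inS| + #|inL|.
  apply: leq_trans (leq_card_setU _ _); apply/subset_leq_card/fintype.subsetP => x.
  by rewrite !inE => /andP[-> ->]; case: (long x y).
have outU : #|[set z in V | e y z]| <= #|outS| + #|outL|.
  apply: leq_trans (leq_card_setU _ _); apply/subset_leq_card/fintype.subsetP => x.
  by rewrite !inE => /andP[-> ->]; case: (long y x).
by case/orP => small; apply/orP; [left | right]; lia.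
Qed.

Lemma card_degree_small (N : nat) (V : {set 'I_N}) (M : nat) (e e' : rel 'I_N) :
  0 < M ->
  (forall x y : 'I_N, x < y -> e x y || e' x y) ->
  {in V, forall y,
    (#|[set x in V | e x y]| < M.*2) || (#|[set z in V | e y z]| < M.*2)} ->
  {in V, forall y,
    (#|[set x in V | e' x y]| < M.*2) || (#|[set z in V | e' y z]| < M.*2)} ->
  #|V| < 32 * M.
Proof.
move=> M0 ee' eV e'V.
(* The booleans tell, for [e] and [e'], whether the in-degree (true) or the out-degree (false) is
   the small one. *)
pose flip p (r : rel 'I_N) u v := if p then r v u else r u v.
pose X p q := [set y in V | (#|[set x in V | flip p e y x]| < M.*2) &&
                            (#|[set x in V | flip q e' y x]| < M.*2)].
have cardX p q : #|X p q| < M.*2.*2.*2.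
  (* An edge uv is charged to u if it lies on the side of u where its color has
     small degree at u. *)
  apply: (@tournament_card _ (fun u v => flip p e u v || flip q e' u v)).
  - by rewrite !double_gt0.
  - move=> u v _ _; rewrite neq_ltn => /orP[] /ee' /orP[] uv;
      case: p; case: q; rewrite /flip uv ?orbT //.
  move=> u; rewrite inE => /and3P[uV cu cu'].
  apply: leq_ltn_trans (_ : #|[set x in V | flip p e u x] :|:
                              [set x in V | flip q e' u x]| < _).
    apply/subset_leq_card/fintype.subsetP => v; rewrite !inE.
    by case/andP => /andP[-> _].
  by apply: leq_ltn_trans (leq_card_setU _ _) _; lia.
have : #|V| <= #|X true true| + #|X true false| + (#|X false true| + #|X false false|).
  apply: leq_trans (leq_add (leq_card_setU _ _) (leq_card_setU _ _)).
  apply: leq_trans (leq_card_setU _ _); apply/subset_leq_card/fintype.subsetP => y yV.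
  rewrite !inE yV /=.
  by case/orP: (eV y yV) => ->; case/orP: (e'V y yV) => ->; rewrite ?orbT.
move: (cardX true true) (cardX true false) (cardX false true) (cardX false false).
lia.
Qed.

(** * The recursion and the resulting Ramsey bound *)

(** Induction on [a + b]: each doubling of one path length costs a factor 32, and a single vertex
    settles the case of a zero exponent. *)
Lemma sqpath_ramsey (N : nat) (e e' : rel 'I_N) (a b : nat) (V : {set 'I_N}) :
  (forall x y, e x y -> x < y) -> (forall x y, e' x y -> x < y) ->
  (forall x y : 'I_N, x < y -> e x y || e' x y) ->
  32 ^ (a + b) <= #|V| ->
  (exists2 w, sqpath e V w & 2 ^ a <= size w) \/
  (exists2 w, sqpath e' V w & 2 ^ b <= size w).
Proof.
move=> elt e'lt ee'; have e'e (x y : 'I_N) : x < y -> e' x y || e x y.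
  by rewrite orbC; apply: ee'.
have [k] := ubnP (a + b); elim: k => // k IHk in a b V *.
have single (r : rel 'I_N) (U : {set 'I_N}) :
    0 < #|U| -> exists2 w, sqpath r U w & 1 <= size w.
  by case/card_gt0P => x xU; exists [:: x]; rewrite //= xU.
case: a => [|a]; first by move=> _ leV; left; apply: single; apply: leq_trans leV; rewrite expn_gt0.
case: b => [|b]; first by move=> _ leV; right; apply: single; apply: leq_trans leV; rewrite expn_gt0.
move=> abk leV; apply: contrapT => /not_orP[nred nblue].
have Ne w : sqpath e V w -> size w < (2 ^ a).*2.
  by move=> pw; rewrite ltnNge -mul2n -expnS; apply/negP => sw; apply: nred; exists w.
have Ne' w : sqpath e' V w -> size w < (2 ^ b).*2.
  by move=> pw; rewrite ltnNge -mul2n -expnS; apply/negP => sw; apply: nblue; exists w.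
(* The pairs [a, b.+1] and [a.+1, b] have the same sum, so one threshold serves both colors. *)
pose M := 32 ^ (a + b).+1.
have M0 : 0 < M by rewrite expn_gt0.
have mono (r : rel 'I_N) (A : {set 'I_N}) w :
    A \subset V -> sqpath r A w -> sqpath r V w.
  by move=> AV pw; rewrite -[w]cats0; apply: (sqpath_cat AV (finset.sub0set V)) => // x y; rewrite !inE.
(* The other outcome of the induction hypothesis is a full-length path in the other color, which [V]
   does not contain. *)
have He (A : {set 'I_N}) : A \subset V -> M <= #|A| ->
    exists2 w, sqpath e A w & 2 ^ a <= size w.
  move=> AV leA; have [||//|[w pw sw]] := IHk a b.+1 A; [lia|by rewrite addnS|].
  by have := Ne' _ (mono _ _ _ AV pw); rewrite -mul2n -expnS; lia.
have He' (A : {set 'I_N}) : A \subset V -> M <= #|A| ->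
    exists2 w, sqpath e' A w & 2 ^ b <= size w.
  move=> AV leA; have [||[w pw sw]|//] := IHk a.+1 b A; [lia|by rewrite addSn|].
  by have := Ne _ (mono _ _ _ AV pw); rewrite -mul2n -expnS; lia.
have pos i : 0 < 2 ^ i by rewrite expn_gt0.
have : #|V| < 32 * M.
  apply: (card_degree_small M0 ee') => y.
    exact: indegree_or_outdegree_small (pos a) elt ee' He He' Ne Ne' y.
  exact: indegree_or_outdegree_small (pos b) e'lt e'e He' He Ne' Ne y.
by rewrite /M -expnS -addSn -addnS ltnNge leV.
Qed.

Lemma mono_copy_sqpath (N : nat) (c : coloring N) (col : bool) (n : nat)
    (V : {set 'I_N}) (w : seq 'I_N) :
  sqpath (fun x y : 'I_N => (x < y) && (c [set x; y] == col)) V w -> n <= size w ->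
  mono_copy c col (path_power 2 (n := n)).
Proof.
move=> pw nw.
(* An empty [w] forces [n = 0]; otherwise its head is the default value for [nth]. *)
case: w pw nw => [_|x0 w0].
  rewrite leqn0 => /eqP->; apply/existsP; exists (ffun0 (card_ord 0)).
  by apply/andP; split; apply/forallP => -[].
move: (x0 :: w0) => w pw nw.
have edge i j : i < j <= i.+2 -> j < size w ->
    nth x0 w i < nth x0 w j /\ c [set nth x0 w i; nth x0 w j] == col.
  by move=> ij jw; apply/andP; apply: sqpath_nth pw ij jw.
(* Edges only compare entries at most two apart; chaining consecutive ones orders the whole list. *)
have ltw i j : i < j -> j < size w -> nth x0 w i < nth x0 w j.
  elim: j => // j IHj; rewrite ltnS leq_eqVlt => /orP[/eqP->|ij] jw.
    by have [|] := edge j j.+1 _ jw; first lia.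
  apply: ltn_trans (IHj ij (ltnW jw)) _.
  by have [|] := edge j j.+1 _ jw; first lia.
apply/existsP; exists [ffun i : 'I_n => nth x0 w i].
apply/andP; split; apply/forallP => i; apply/forallP => j; apply/implyP; rewrite !ffunE.
  by move=> ij; apply: ltw => //; apply: leq_trans nw.
rewrite /path_power => ij.
have [lt_ij|lt_ji|eq_ij] := ltngtP i j; last by move: ij; lia.
  by apply: (edge _ _ _ _).2; [move: ij; lia | apply: leq_trans nw].
by rewrite finset.setUC; apply: (edge _ _ _ _).2; [move: ij; lia | apply: leq_trans nw].
Qed.

Lemma ordered_ramsey_le (a n : nat) :
  n <= 2 ^ a -> ordered_ramsey 2 n n <= 32 ^ (a + a).
Proof.
move=> na; rewrite /ordered_ramsey; case: ex_minnP => m _; apply.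
apply/forallP => c; apply/orP.
pose e col (x y : 'I_(32 ^ (a + a))) := (x < y) && (c [set x; y] == col).
have [|||||] := @sqpath_ramsey _ (e true) (e false) a a [set: 'I_(32 ^ (a + a))].
- by move=> x y /andP[].
- by move=> x y /andP[].
- by move=> x y xy; rewrite /e xy; case: (c _).
- by rewrite cardsT card_ord.
- by case=> w pw sw; left; apply: mono_copy_sqpath pw (leq_trans na sw).
- by case=> w pw sw; right; apply: mono_copy_sqpath pw (leq_trans na sw).
Qed.

Import Order.TTheory GRing.Theory Num.Theory.
Local Open Scope ring_scope.

Theorem theorem1 (R : realType) :
  exists2 c : R, 0 < c &
    forall n : nat, (1 < n)%N ->
      (ordered_ramsey 2 n n)%:R < c * n%:R `^ (19 + 487 / 1000).
Proof.
(* The bound found is [(2 * n) ^ 10]; the extra 1 makes the inequality strict. *)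
exists (2 ^+ 10 + 1) => [|n n1]; first by rewrite ltr_wpDl ?exprn_ge0.
have n0 : (0 < n)%N by exact: ltnW.
have n0R : 0 < n%:R :> R by rewrite ltr0n.
have [le_n lt_n] : (n <= 2 ^ up_log 2 n)%N /\ (2 ^ up_log 2 n < 2 * n)%N.
  have /andP[lo hi] := up_log_bounds (isT : (1 < 2)%N) n1.
  split=> //; rewrite -(@prednK (up_log 2 n)) ?up_log_gt0 //.
  by rewrite expnS ltn_pmul2l.
have bound : (ordered_ramsey 2 n n <= (2 * n) ^ 10)%N.
  apply: leq_trans (ordered_ramsey_le le_n) _.
  (* The exponent 10 arises as [32 ^ (k + k) = (2 ^ k) ^ 10], where [2 ^ k] is [n] rounded up to a
     power of two. *)
  rewrite (_ : 32 = 2 ^ 5)%N // -expnM (_ : 5 * _ = up_log 2 n * 10)%N; last lia.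
  by rewrite expnM leq_exp2r // ltnW.
apply: (@le_lt_trans _ _ (2 ^+ 10 * n%:R `^ 10)).
  by rewrite powR_mulrn ?ler0n // -exprMn -natrM -natrX ler_nat.
apply: (@le_lt_trans _ _ (2 ^+ 10 * n%:R `^ (19 + 487 / 1000))).
  rewrite ler_wpM2l ?exprn_ge0 // ler_powR ?ler1n //; lra.
by rewrite ltr_pM2r ?powR_gt0 // ltrDl.
Qed.
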